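(* Let $\mathcal{H}$ be a finite-dimensional Hilbert space with norm $\|\cdot\|$, let $\|\cdot\|_*$ be a norm on $\mathcal{H}$, let $A:\mathcal{H}\to\mathbb{R}^m$ be linear, and let $\mathcal{C}\subseteq\mathcal{H}$ be a subset. For $\epsilon\ge 0$ consider the convex program $$\min_{x\in\mathcal{H}} \|x\|_* \quad\text{subject to}\quad \|Ax-b\|_2\le\epsilon, \qquad (\ast)$$ where $b=A\check{x}_0+n$ with $\check{x}_0\in\mathcal{H}$, $n\in\mathbb{R}^m$ and $\|n\|_2\le\epsilon$. Suppose that there exists a $\theta>0$ such that $$\mathcal{D}^{\wedge\theta}(\|\cdot\|_*,x_0)\cap\ker A=\{0\}\quad\text{for every } x_0\in\mathcal{C}.$$ Then there exist constants $\kappa_1$ and $\kappa_2$ such that any solution $x^*$ of $(\ast)$ fulfills $$\|x^*-\check{x}_0\|\le\kappa_1\,\epsilon+\kappa_2\,\mathrm{dist}_{\|\cdot\|_*}(\check{x}_0,\mathrm{cone}(\mathcal{C})).$$ Here $\kappa_1$ depends only on $\sigma_{\min}(A)$, $\|\cdot\|_*$ and $\theta$, and $\kappa_2$ depends only on $\theta$, $\|\cdot\|_*$ and the condition number $\sigma_{\max}(A)/\sigma_{\min}(A)$ of $A$.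
   Context: $\|\cdot\|$ denotes the norm induced by the inner product $\langle\cdot,\cdot\rangle$ of $\mathcal{H}$; $\mathbb{R}^m$ carries the Euclidean norm $\|\cdot\|_2$. The descent cone of a function $f:\mathcal{H}\to\mathbb{R}$ at $x_0$ is $\mathcal{D}(f,x_0)=\{\eta\in\mathcal{H} : \exists \tau>0,\ f(x_0+\tau\eta)\le f(x_0)\}$. For a convex cone $C\subseteq\mathcal{H}$ (a convex set with $\tau C=C$ for all $\tau>0$) and $\theta\in[0,\pi]$, the $\theta$-expansion of $C$ is $C^{\wedge\theta}=\{0\}\cup\{x\in\mathcal{H} : \exists y\in C\setminus\{0\},\ \langle x,y\rangle\ge\cos(\theta)\|x\|\|y\|\}$. One writes $\mathcal{D}^{\wedge\theta}(f,x_0)=(\mathcal{D}(f,x_0))^{\wedge\theta}$, and ''$\theta>0$'' means $\theta\in(0,\pi]$. $\mathrm{cone}(\mathcal{C})=\{\lambda x_0 : \lambda>0,\ x_0\in\mathcal{C}\}$, and $\mathrm{dist}_{\|\cdot\|_*}(x,S)=\inf_{c\in S}\|x-c\|_*$. $\sigma_{\min}(A)$ and $\sigma_{\max}(A)$ denote the smallest and largest non-zero singular values of $A$. *)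

(* Defs.v *)
From HB Require Import structures.
From mathcomp Require Export all_boot all_order all_algebra.
From mathcomp Require Export sesquilinear.
From mathcomp Require Export all_classical all_reals all_analysis.

Set Implicit Arguments.
Unset Strict Implicit.
Unset Printing Implicit Defensive.

Import Order.TTheory GRing.Theory Num.Theory.
Local Open Scope classical_set_scope.
Local Open Scope ring_scope.

(* A finite-dimensional real Hilbert space is a vectType H over R : realType
   with a positive definite symmetric bilinear form ip : {dot H for idfun}. *)

Definition hnorm (R : realType) (H : vectType R) (ip : {dot H for idfun})
  (x : H) : R := Num.sqrt (ip x x).

(* Needed because the library norm on matrices is the sup norm. *)
Definition dotcV (R : realType) (m : nat) (y z : 'cV[R]_m) : R :=
  \sum_(i < m) y i 0 * z i 0.

Definition l2norm (R : realType) (m : nat) (y : 'cV[R]_m) : R :=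
  Num.sqrt (dotcV y y).

Record is_norm (R : realType) (H : vectType R) (N : H -> R) : Prop := IsNorm {
  norm_triangle : forall x y, N (x + y) <= N x + N y ;
  norm_homogeneous : forall (a : R) x, N (a *: x) = `|a| * N x ;
  norm_definite : forall x, N x = 0 -> x = 0 }.

Definition descent_cone (R : realType) (H : vectType R) (f : H -> R) (x0 : H) :
    set H :=
  [set eta | exists2 tau : R, 0 < tau & f (x0 + tau *: eta) <= f x0].

Definition expansion (R : realType) (H : vectType R) (ip : {dot H for idfun})
    (theta : R) (C : set H) : set H :=
  [set 0] `|` [set x | exists y, [/\ C y, y != 0 &
                         cos theta * hnorm ip x * hnorm ip y <= ip x y]].

Definition cone (R : realType) (H : vectType R) (C : set H) : set H :=
  [set x | exists lambda : R, exists x0 : H,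
     [/\ 0 < lambda, C x0 & x = lambda *: x0]].

(* Extended-real valued, so that the distance to the empty set is +oo. *)
Definition edist (R : realType) (H : vectType R) (N : H -> R)
    (x : H) (S : set H) : \bar R :=
  ereal_inf [set (N (x - c))%:E | c in S].

Definition is_adjoint (R : realType) (H : vectType R) (ip : {dot H for idfun})
    (m : nat) (A : 'Hom(H, 'cV[R]_m)) (B : 'Hom('cV[R]_m, H)) : Prop :=
  forall x y, dotcV (A x) y = ip x (B y).

Definition adjoint (R : realType) (H : vectType R) (ip : {dot H for idfun})
    (m : nat) (A : 'Hom(H, 'cV[R]_m)) : 'Hom('cV[R]_m, H) :=
  xget 0 [set B | is_adjoint ip A B].

Lemma adjointP (R : realType) (H : vectType R) (ip : {dot H for idfun})
  (m : nat) (A : 'Hom(H, 'cV[R]_m)) : is_adjoint ip A (adjoint ip A).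
Proof.
pose n := \dim {:H}; pose e := vbasis {:H}.
have ipC x y : ip x y = ip y x by rewrite hermC /= expr0 mul1r.
pose g (x : H) : 'rV[R]_n := \row_i ip x e`_i.
have lin_g : linear g.
  by move=> a x y; apply/rowP => i; rewrite !mxE linearPl.
pose gL := GRing.isLinear.Build R H 'rV[R]_n *:%R g lin_g.
pose g' : {linear H -> 'rV[R]_n} := HB.pack g gL.
have ip_basis x z : (forall i : 'I_n, ip x e`_i = ip z e`_i) ->
    forall y, ip x y = ip z y.
  move=> xz y; have /coord_vbasis -> : y \in (fullv : {vspace H}) by rewrite memvf.
  rewrite !linear_sum /=; apply: eq_bigr => i _.
  by rewrite !linearZr_LR /= xz.
pose f := linfun g'.
have fE x i : f x 0 i = ip x e`_i by rewrite lfunE mxE.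
have kerf : lker f == 0%VS.
  rewrite -subv0; apply/subvP => x; rewrite memv_ker memv0 => /eqP fx0.
  apply: contraT => /(@neq0_dnorm_gt0 _ _ _ ip).
  rewrite (@ip_basis x 0) => [|i]; first by rewrite linear0l ltxx.
  by rewrite -fE fx0 mxE linear0l.
have imf : limg f = fullv.
  apply/eqP; rewrite eqEdim subvf /= limg_dim_eq; last first.
    by rewrite (eqP kerf) capv0.
  by rewrite [X in (X <= _)%N]dimvf /dim /= mul1n.
pose h (y : 'cV[R]_m) : 'rV[R]_n := \row_i dotcV (A e`_i) y.
have dotP (u : 'cV[R]_m) : scalar (dotcV u).
  move=> a y z; rewrite /dotcV mulr_sumr -big_split /=.
  by apply: eq_bigr => i _; rewrite !mxE mulrDr mulrCA.
have dotC (u v : 'cV[R]_m) : dotcV u v = dotcV v u.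
  by apply: eq_bigr => i _; rewrite mulrC.
have lin_h : linear h.
  by move=> a x y; apply/rowP => i; rewrite !mxE dotP.
pose hL := GRing.isLinear.Build R 'cV[R]_m 'rV[R]_n *:%R h lin_h.
pose h' : {linear 'cV[R]_m -> 'rV[R]_n} := HB.pack h hL.
pose B := (f^-1 \o linfun h')%VF.
have BE y (i : 'I_n) : ip (B y) e`_i = dotcV (A e`_i) y.
  rewrite -fE /B comp_lfunE limg_lfunVK ?imf ?memvf //.
  by rewrite lfunE mxE.
suff adjB : is_adjoint ip A B by apply: (@xgetPex _ 0 [set B | is_adjoint ip A B]); exists B.
move=> x y; rewrite ipC.
have /coord_vbasis {1 2}-> : x \in (fullv : {vspace H}) by rewrite memvf.
rewrite !linear_sum /= dotC.
pose dL := GRing.isLinear.Build R 'cV[R]_m R *%R (dotcV y) (dotP y).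
pose d' : {linear 'cV[R]_m -> R | *%R} := HB.pack (dotcV y) dL.
rewrite -[dotcV y]/(d' : _ -> _) linear_sum; apply: eq_bigr => i _.
by rewrite !linearZ /= dotC -BE.
Qed.

(* Square roots of the nonzero eigenvalues of A^* A. *)
Definition nonzero_singular_values (R : realType) (H : vectType R)
    (ip : {dot H for idfun}) (m : nat) (A : 'Hom(H, 'cV[R]_m)) : set R :=
  [set s | 0 < s /\ passmx.leigenvalue (adjoint ip A \o A)%VF (s ^+ 2)].

(* The set of nonzero singular values is finite, so inf and sup are its minimum
   and maximum; both are 0 for A = 0, which has no nonzero singular value. *)
Definition sigma_min (R : realType) (H : vectType R) (ip : {dot H for idfun})
    (m : nat) (A : 'Hom(H, 'cV[R]_m)) : R :=
  inf (nonzero_singular_values ip A).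

Definition sigma_max (R : realType) (H : vectType R) (ip : {dot H for idfun})
    (m : nat) (A : 'Hom(H, 'cV[R]_m)) : R :=
  sup (nonzero_singular_values ip A).

Definition is_solution (R : realType) (H : vectType R) (N : H -> R)
    (m : nat) (A : 'Hom(H, 'cV[R]_m)) (b : 'cV[R]_m) (eps : R) (x : H) : Prop :=
  l2norm (A x - b) <= eps /\
  forall z : H, l2norm (A z - b) <= eps -> N x <= N z.

(* Main.v *)
From HB Require Import structures.
Require Import Defs.
From mathcomp Require Import ring lra.

(** Let [x0] be a point of the cone over [C], put [d = N (xc - x0)], and let [xs]
    be a solution. Since [xc] is feasible, [N xs <= N xc <= N x0 + d]: up to
    [d], the vector [xs - x0] descends from [x0]. Shrinking [xs] to [t *: xs] in
    the [N]-ball of radius [N x0] costs [(1 - t) * N xs <= d]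
    ([shrink_to_sublevel]), and [y = t *: xs - x0] is then a genuine descent
    direction, at [N]-distance at most [2 * d] from [xs - xc].

    Descent directions stay away from the kernel of [A]. If [k] is the orthogonal
    projection of [y] on [ker A], then [ip k y] is the square of the norm of [k].
    As [k] lies outside the expanded cone unless it is [0], the angle between [k]
    and [y] exceeds [theta]; so the norm of [k] is at most [cos theta] times
    that of [y] (or [k = 0], if [cos theta <= 0]), and the part [y - k]
    orthogonal to [ker A] keeps the fraction [sin_acute theta] of the norm of
    [y]. On the orthogonal complement of [ker A] the map [A] is bounded below by
    [sigma_min], whence [sin_acute theta * |y| <= |A y| / sigma_min]
    ([descent_cone_transverse]).

    Finally [A y] is within [sigma_max * |y - (xs - xc)|] of [A (xs - xc)], whose
    norm is at most [2 * eps] by feasibility of both points. Comparing [N] with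
    the Hilbert norm turns this into a bound by [eps] and [d]
    ([recovery_bound]); the infimum over [x0] gives the distance to the cone.

    Two facts of finite-dimensional analysis carry this argument: the
    equivalence of norms, and the extremality of the singular values for
    [|A x| / |x|]. Both follow from a single compactness statement
    ([attains_min_homogeneous]): a function that is continuous away from [0] and
    constant on punctured lines attains its minimum on a subspace. Applied to a
    Rayleigh quotient, it yields an eigenvector ([rayleigh_min]). *)

Set Implicit Arguments.
Unset Strict Implicit.
Unset Printing Implicit Defensive.

Import Order.TTheory GRing.Theory Num.Theory.
Import numFieldNormedType.Exports.
Local Open Scope classical_set_scope.
Local Open Scope ring_scope.

(** * Norms on a finite-dimensional space *)

Section NormTheory.
Variables (R : realType) (V : vectType R) (N : V -> R).
Hypothesis hN : is_norm N.

Lemma is_norm0 : N 0 = 0.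
Proof. by rewrite -(scale0r 0) (norm_homogeneous hN) normr0 mul0r. Qed.

Lemma is_normN x : N (- x) = N x.
Proof. by rewrite -scaleN1r (norm_homogeneous hN) normrN1 mul1r. Qed.

Lemma is_norm_sub x y : N (x - y) <= N x + N y.
Proof. by rewrite -[N y]is_normN (norm_triangle hN). Qed.

Lemma is_norm_ge0 x : 0 <= N x.
Proof.
have := is_norm_sub x x; rewrite subrr is_norm0 -mulr2n => h.
by rewrite -(@pmulrn_lge0 _ _ 2).
Qed.

Lemma is_norm_gt0 x : (0 < N x) = (x != 0).
Proof.
rewrite lt_def is_norm_ge0 andbT; congr (~~ _).
by apply/eqP/eqP => [/(norm_definite hN)|->] //; exact: is_norm0.
Qed.

Lemma is_norm_dist x y : `|N x - N y| <= N (x - y).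
Proof.
rewrite ler_norml lerBlDr; apply/andP; split; last first.
  by apply: le_trans (norm_triangle hN _ _); rewrite subrK.
rewrite -[N (x - y)]is_normN opprB lerNl opprB lerBlDr.
by apply: le_trans (norm_triangle hN _ _); rewrite subrK.
Qed.

Lemma is_norm_sum (I : finType) (F : I -> V) :
  N (\sum_i F i) <= \sum_i N (F i).
Proof.
elim/big_ind2 : _ => // [|x1 x2 y1 y2 h1 h2]; first by rewrite is_norm0.
by apply: le_trans (norm_triangle hN _ _) _; apply: lerD.
Qed.

End NormTheory.

(** * Real inner products *)

Section InnerProduct.
Variables (R : realType) (V : vectType R) (ip : {dot V for idfun}).

Lemma ipC x y : ip x y = ip y x.
Proof. by rewrite hermC /= expr0 mul1r. Qed.

Lemma ip_ge0 x : 0 <= ip x x.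
Proof.
have [->|/(@neq0_dnorm_gt0 _ _ _ ip)/ltW//] := eqVneq x 0.
by rewrite linear0l.
Qed.

Lemma ipZl a x y : ip (a *: x) y = a * ip x y.
Proof. exact: linearZl_LR. Qed.

Lemma ipZr a x y : ip x (a *: y) = a * ip x y.
Proof. exact: linearZr_LR. Qed.

Lemma hnorm_ge0 x : 0 <= hnorm ip x. Proof. exact: sqrtr_ge0. Qed.

Lemma sqr_hnorm x : hnorm ip x ^+ 2 = ip x x.
Proof. by rewrite sqr_sqrtr // ip_ge0. Qed.

Lemma ipDZ x y (t : R) :
  ip (x + t *: y) (x + t *: y) = ip x x + 2 * t * ip x y + t ^+ 2 * ip y y.
Proof.
by rewrite linearDl /= !linearDr /= !ipZl !ipZr (ipC y x); ring.
Qed.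

Lemma ip_cauchy_schwarz x y : ip x y <= hnorm ip x * hnorm ip y.
Proof.
have [->|x0] := eqVneq x 0.
  by rewrite linear0l mulr_ge0 ?hnorm_ge0.
have xx : 0 < ip x x by exact: neq0_dnorm_gt0.
rewrite -[_ * _]ger0_norm ?mulr_ge0 ?hnorm_ge0 //.
apply: le_trans (ler_norm _) _; rewrite -ler_sqr ?nnegrE // !real_normK ?num_real //.
rewrite exprMn !sqr_hnorm -subr_ge0.
(* The component of y orthogonal to x has a nonnegative square. *)
have := ip_ge0 (y + (- (ip x y / ip x x)) *: x); rewrite ipDZ (ipC y x).
set a := ip x y; set b := ip x x; set c := ip y y => h.
have -> : b * c - a ^+ 2 = b * (c + 2 * - (a / b) * a + (- (a / b)) ^+ 2 * b).
  by field; rewrite gt_eqF.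
by rewrite mulr_ge0 // ltW.
Qed.

Lemma hnorm_is_norm : is_norm (hnorm ip).
Proof.
split => [x y|a x|x /eqP].
- rewrite -ler_sqr ?nnegrE ?addr_ge0 ?hnorm_ge0 // sqr_hnorm.
  rewrite -[y]scale1r ipDZ scale1r sqrrD !sqr_hnorm.
  by have := ip_cauchy_schwarz x y; lra.
- rewrite /hnorm ipZl ipZr mulrA -expr2.
  by rewrite sqrtrM ?sqr_ge0 // sqrtr_sqr.
- apply: contraTeq => /(@neq0_dnorm_gt0 _ _ _ ip) xx.
  by rewrite sqrtr_eq0 -ltNge.
Qed.

End InnerProduct.

(** * Compactness: minima of degree-0 homogeneous functions *)

Section Compactness.
Variables (R : realType) (V : vectType R) (U : {vspace V}).

(** Coordinates carry the topology of row vectors to [U]; [V] itself has none. *)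
Definition span_param (x : 'rV[R]_(\dim U)) : V :=
  \sum_i x 0 i *: (vbasis U)`_i.

Lemma span_param_in x : span_param x \in U.
Proof.
by apply: memv_suml => i _; rewrite memvZ // vbasis_mem // mem_nth // size_tuple.
Qed.

Lemma span_param_eq0 x : span_param x = 0 -> x = 0.
Proof.
move=> x0; apply/rowP => i.
rewrite -(coord_sum_free (fun i => x 0 i) i (basis_free (vbasisP U))).
by rewrite [X in coord _ _ X]x0 linear0 mxE.
Qed.

Lemma span_paramZ a x : span_param (a *: x) = a *: span_param x.
Proof.
by rewrite /span_param scaler_sumr; apply: eq_bigr => i _; rewrite mxE scalerA.
Qed.

Lemma span_paramB x y : span_param (x - y) = span_param x - span_param y.
Proof.
by rewrite /span_param -sumrB; apply: eq_bigr => i _; rewrite !mxE scalerBl.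
Qed.

Lemma span_param_onto v : v \in U -> exists x, v = span_param x.
Proof.
move=> /coord_vbasis ->; exists (\row_i coord (vbasis U) i v).
by apply: eq_bigr => i _; rewrite mxE.
Qed.

Lemma finite_sum_continuous n (T : topologicalType) (g : 'I_n -> T -> R) :
  (forall i, continuous (g i)) -> continuous (fun x => \sum_i g i x).
Proof.
move=> hg; apply: continuous_big => [|i _]; last exact: hg.
by move=> z; apply: (@continuousD _ _ _ fst snd); [exact: cvg_fst|exact: cvg_snd].
Qed.

Lemma dist_coord_continuous n (x : 'rV[R]_n) (c : R) i :
  continuous (fun y : 'rV[R]_n => `|(x - y) 0 i| * c).
Proof.
have cB : continuous (fun y : 'rV[R]_n => (x - y) 0 i).
  have -> : (fun y => (x - y) 0 i) = (fun y : 'rV[R]_n => x 0 i - y 0 i).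
    by apply/funext => y; rewrite !mxE.
  move=> y; apply: continuousB; first exact: cst_continuous.
  exact: coord_continuous.
move=> y; apply: (continuousM _ (@cst_continuous _ _ c y)).
exact: (continuous_comp (cB y) (@norm_continuous _ _ _)).
Qed.

(** By the triangle inequality the variation of [N] is at most a weighted sum of
    coordinate differences, which is continuous and vanishes at the base point. *)
Lemma norm_span_param_continuous (N : V -> R) :
  is_norm N -> continuous (N \o span_param).
Proof.
move=> hN x; pose K (y : 'rV[R]_(\dim U)) := \sum_i `|(x - y) 0 i| * N (vbasis U)`_i.
have K_cont : continuous K.
  by apply: finite_sum_continuous => i; exact: dist_coord_continuous.
have K0 : K x = 0.
  by rewrite /K subrr big1 // => i _; rewrite mxE normr0 mul0r.
have xF := @nbhs_filter 'rV[R]_(\dim U) x.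
apply/cvgrPdist_le => e e0; move/cvgrPdist_le : (K_cont x) => /(_ e e0).
apply: filterS => y; rewrite K0 sub0r normrN => hy.
apply: le_trans (is_norm_dist hN _ _) _; rewrite -span_paramB.
apply: le_trans (is_norm_sum hN _) _; apply: le_trans hy.
apply: le_trans (ler_norm _); apply: ler_sum => i _.
by rewrite (norm_homogeneous hN).
Qed.

(** Homogeneity reduces the minimization to the unit sphere of the coordinate
    space, which is compact, and on which the parametrized vector is nonzero, so
    that quotients by norms are continuous there. *)
Lemma attains_min_homogeneous (f : V -> R) :
  U != 0%VS ->
  (forall a x, a != 0 -> f (a *: x) = f x) ->
  (forall x, span_param x != 0 -> {for x, continuous (f \o span_param)}) ->
  exists v, [/\ v \in U, v != 0 & forall x, x \in U -> x != 0 -> f v <= f x].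
Proof.
move=> U0 fZ fc; pose S := [set x : 'rV[R]_(\dim U) | `|x| = 1].
have normalize v : v \in U -> v != 0 ->
    exists x a, [/\ S x, a != 0 & span_param x = a *: v].
  move=> vU v0; have [x vx] := span_param_onto vU.
  have x0 : x != 0.
    by apply: contraNneq v0 => xE; rewrite vx xE -(scale0r 0) span_paramZ scale0r.
  exists (`|x|^-1 *: x), `|x|^-1; split.
  - by rewrite /S /= normrZ normfV normr_id mulVf // normr_eq0.
  - by rewrite invr_eq0 normr_eq0.
  - by rewrite span_paramZ vx.
have Sparam x : S x -> span_param x != 0.
  move=> Sx; apply/eqP => /span_param_eq0 x0; move: Sx.
  by rewrite /S /= x0 normr0 => /esym/eqP; rewrite oner_eq0.
have [x xS xmin] : exists2 x, x \in S & forall y, y \in S ->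
    f (span_param x) <= f (span_param y).
  apply: (@EVT_min_rV _ _ (f \o span_param)).
  - have [x [a [Sx _ _]]] : exists x a, [/\ S x, a != 0 &
        span_param x = a *: vpick U].
      by apply: normalize; rewrite ?memv_pick // vpick0.
    by exists x.
  - apply: bounded_closed_compact.
      exists 1; split => // M M1 y Sy.
      by apply: le_trans (ltW M1); rewrite le_eqVlt; apply/orP; left; apply/eqP.
    apply: (@preimage_closed _ _ (fun y : 'rV[R]_(\dim U) => `|y|) [set 1]).
      by move=> y _; exact: norm_continuous.
    exact: closed_eq.
  - by apply: continuous_in_subspaceT => y /set_mem/Sparam; exact: fc.
move/set_mem : xS => Sx.
exists (span_param x); split; [exact: span_param_in|exact: Sparam|].
move=> y yU y0; have [z [a [Sz a0 zE]]] := normalize y yU y0.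
by rewrite -(fZ a y a0) -zE xmin // mem_set.
Qed.

End Compactness.

(** The constant is [N1 v / N2 v], where [v] minimizes [N2 / N1]. *)
Lemma norms_equivalent (R : realType) (V : vectType R) (N1 N2 : V -> R) :
  is_norm N1 -> is_norm N2 -> exists2 c, 0 < c & forall x, N1 x <= c * N2 x.
Proof.
move=> h1 h2; have [V0|V0] := eqVneq (fullv : {vspace V}) 0%VS.
  exists 1 => // x; have : x \in (fullv : {vspace V}) by rewrite memvf.
  by rewrite V0 memv0 => /eqP->; rewrite (is_norm0 h1) (is_norm0 h2) mulr0.
have [||v [_ v0 vmin]] := @attains_min_homogeneous _ _ fullv (fun x => N2 x / N1 x) V0.
- move=> a x a0; rewrite !(norm_homogeneous h1) !(norm_homogeneous h2).
  by rewrite invfM mulrACA divff ?normr_eq0 // mul1r.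
- move=> x; rewrite -(is_norm_gt0 h1) => /lt0r_neq0 x0.
  apply: (continuousM (norm_span_param_continuous h2 (x := x))).
  exact: (continuousV x0 (norm_span_param_continuous h1 (x := x))).
have v1 : 0 < N1 v by rewrite (is_norm_gt0 h1).
have v2 : 0 < N2 v by rewrite (is_norm_gt0 h2).
exists (N1 v / N2 v) => [|x]; first by rewrite divr_gt0.
have [->|x0] := eqVneq x 0; first by rewrite (is_norm0 h1) (is_norm0 h2) mulr0.
have := vmin x (memvf _) x0; have x1 : 0 < N1 x by rewrite (is_norm_gt0 h1).
rewrite ler_pdivlMr // mulrAC ler_pdivrMr // => h.
by rewrite mulrAC ler_pdivlMr // mulrC [leRHS]mulrC.
Qed.

(** * Extremal eigenvectors of a symmetric operator *)

Section Rayleigh.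
Variables (R : realType) (V : vectType R) (ip : {dot V for idfun}).
Variables (U : {vspace V}) (S : 'End(V)).

Lemma form_span_param_continuous :
  continuous (fun x => ip (S (span_param x)) (@span_param _ _ U x)).
Proof.
have coordM (i : 'I_(\dim U)) (g : 'rV[R]_(\dim U) -> R) : continuous g ->
    continuous (fun x : 'rV[R]_(\dim U) => x 0 i * g x).
  by move=> gc x; exact: (continuousM (@coord_continuous _ _ _ 0 i x) (gc x)).
pose b i j := ip (S (vbasis U)`_j) (vbasis U)`_i.
have -> : (fun x => ip (S (span_param x)) (@span_param _ _ U x)) =
    fun x => \sum_(i < \dim U) x 0 i * \sum_(j < \dim U) x 0 j * b i j.
  apply/funext => x; rewrite {2}/span_param linear_sumr.
  apply: eq_bigr => i _; rewrite [LHS]ipZr; congr (_ * _).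
  rewrite ipC /span_param !linear_sum; apply: eq_bigr => j _.
  by rewrite linearZ [LHS]ipZr ipC.
apply: finite_sum_continuous => i; apply: (coordM).
by apply: finite_sum_continuous => j; apply: coordM; exact: cst_continuous.
Qed.

(** At a minimizer [v] of the Rayleigh quotient, with value [mu], the form of
    [S - mu] is positive semidefinite on [U] and vanishes at [v]. Its first
    variation at [v] in the direction [w = S v - mu *: v] must vanish, and it
    equals [2 * ip w w]; so [v] is an eigenvector. *)
Lemma rayleigh_min :
  (forall x y, ip (S x) y = ip x (S y)) ->
  (forall x, x \in U -> S x \in U) -> U != 0%VS ->
  exists v mu, [/\ v \in U, v != 0, S v = mu *: v &
    forall x, x \in U -> mu * ip x x <= ip (S x) x].
Proof.
move=> Ssym SU U0; have h := hnorm_is_norm ip.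
have [||v [vU v0 vmin]] := @attains_min_homogeneous _ _ U
    (fun x => ip (S x) x / (hnorm ip x * hnorm ip x)) U0.
- move=> a x a0; rewrite [S _]linearZ ipZl ipZr (norm_homogeneous h) mulrA -expr2.
  rewrite mulrACA -expr2 real_normK ?num_real // invfM mulrACA.
  by rewrite divff ?sqrf_eq0 // mul1r.
- move=> x; rewrite -(is_norm_gt0 h) => x0.
  have hc := norm_span_param_continuous h (x := x).
  apply: (continuousM (form_span_param_continuous (x := x))).
  by apply: (continuousV _ (continuousM hc hc)); rewrite gt_eqF ?mulr_gt0.
pose mu := ip (S v) v / ip v v; have vv : 0 < ip v v by exact: neq0_dnorm_gt0.
have mumin x : x \in U -> mu * ip x x <= ip (S x) x.
  move=> xU; have [->|x0] := eqVneq x 0; first by rewrite !linear0r ?mulr0.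
  have xx : 0 < ip x x by exact: neq0_dnorm_gt0.
  by have := vmin x xU x0; rewrite -!expr2 !sqr_hnorm ler_pdivlMr.
exists v, mu; split => //; apply/eqP; rewrite -subr_eq0; move wE : (_ - _) => w.
have wU : w \in U by rewrite -wE rpredB ?memvZ ?SU.
apply: contraT => /(@neq0_dnorm_gt0 _ _ _ ip) ww.
pose T x := ip (S x) x - mu * ip x x.
have T_ge0 t : 0 <= 2 * t * ip w w + t ^+ 2 * T w.
  have : 0 <= T (v + t *: w) by rewrite subr_ge0 mumin // rpredD ?memvZ.
  have SE : S (v + t *: w) = S v + t *: S w by rewrite linearD linearZ.
  congr (0 <= _); rewrite /T ipDZ SE.
  rewrite linearDl /= !linearDr /= !ipZl !ipZr.
  have -> : ip (S w) v = ip (S v) w by rewrite Ssym ipC.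
  have -> : ip w w = ip (S v) w - mu * ip v w.
    by rewrite -[X in ip X w]wE linearBl /= ipZl.
  have -> : ip (S v) v = mu * ip v v by rewrite /mu divfK ?gt_eqF.
  by rewrite /T; ring.
have Tw : 0 <= T w by rewrite subr_ge0 mumin.
(* For small negative t the linear term 2 t |w|^2 dominates t^2 T(w); the choice
   below is explicit, and the summand 1 only keeps the denominator positive. *)
have := T_ge0 (- (ip w w / (T w + 1))).
have T1 : 0 < T w + 1 by lra.
set t := ip w w / _; have t0 : 0 < t by rewrite divr_gt0.
have -> : ip w w = t * (T w + 1) by rewrite divfK ?gt_eqF.
have -> : 2 * - t * (t * (T w + 1)) + (- t) ^+ 2 * T w =
  - (t ^+ 2 * (T w + 2)) by ring.
by rewrite oppr_ge0 leNgt mulr_gt0 ?exprn_gt0 //; lra.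
Qed.

End Rayleigh.

(** * The Euclidean inner product on columns *)

Section EuclideanDot.
Variables (R : realType) (m : nat).

Let dotcVC (u v : 'cV[R]_m) : dotcV u v = (-1) ^+ false * idfun (dotcV v u).
Proof.
by rewrite expr0 mul1r; apply: eq_bigr => i _; rewrite mulrC.
Qed.

Let dotcVP (u : 'cV[R]_m) : scalar (dotcV u).
Proof.
move=> a y z; rewrite /dotcV mulr_sumr -big_split /=.
by apply: eq_bigr => i _; rewrite !mxE mulrDr mulrCA.
Qed.

Let dotcV_bilinear : bilinear_for *%R (idfun \; *%R) (@dotcV R m).
Proof.
split=> u; last exact: dotcVP.
by move=> a y z; rewrite ![dotcV _ u]dotcVC !expr0 !mul1r /= dotcVP.
Qed.

Let dotcV_gt0 (u : 'cV[R]_m) : u != 0 -> 0 < dotcV u u.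
Proof.
move=> u0; rewrite lt_def sumr_ge0 => [|i _]; last by rewrite -expr2 sqr_ge0.
rewrite andbT; apply: contra u0; rewrite psumr_eq0 => [/allP u0|i _].
  apply/eqP/colP => i; have := u0 i; rewrite mem_index_enum mulf_eq0 orbb mxE.
  by move=> /(_ isT)/eqP.
by rewrite -expr2 sqr_ge0.
Qed.

HB.instance Definition _ := bilinear_isBilinear.Build R _ _ _ _ _ (@dotcV R m)
  dotcV_bilinear.
HB.instance Definition _ := isHermitianSesquilinear.Build R _ false idfun
  (@dotcV R m) dotcVC.
HB.instance Definition _ := isDotProduct.Build R _ (@dotcV R m) dotcV_gt0.

Lemma l2norm_is_norm : is_norm (@l2norm R m).
Proof. exact: (hnorm_is_norm (@dotcV R m : {dot _ for idfun})). Qed.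

Lemma sqr_l2norm (u : 'cV[R]_m) : l2norm u ^+ 2 = dotcV u u.
Proof. exact: (sqr_hnorm (@dotcV R m : {dot _ for idfun})). Qed.

End EuclideanDot.

(** * Extremality of the singular values *)

Section SingularValues.
Variables (R : realType) (V : vectType R) (ip : {dot V for idfun}).
Variables (m : nat) (A : 'Hom(V, 'cV[R]_m)).

Let G : 'End(V) := (adjoint ip A \o A)%VF.

Lemma gramE x y : ip (G x) y = dotcV (A x) (A y).
Proof.
by rewrite comp_lfunE ipC -(adjointP ip A); apply: eq_bigr => i _; rewrite mulrC.
Qed.

Lemma gram_sym x y : ip (G x) y = ip x (G y).
Proof. by rewrite gramE comp_lfunE (adjointP ip A). Qed.

Lemma gram_sqr x : ip (G x) x = l2norm (A x) ^+ 2.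
Proof. by rewrite gramE sqr_l2norm. Qed.

Lemma gram_ker x : G x = 0 -> A x = 0.
Proof.
move=> Gx0; apply: (norm_definite (l2norm_is_norm R m)).
by apply/eqP; rewrite -sqrf_eq0 -gram_sqr Gx0 linear0l.
Qed.

(** Orthogonal projection on [ker A]. For the symmetric operator [G], the adjoint
    of [A] times [A], kernel and image are orthogonal, hence meet in [0] and by
    dimension span the whole space; and [ker G = ker A]. *)
Lemma ker_split x : exists2 k, A k = 0 &
  [/\ x - k \in limg G & ip k x = ip k k].
Proof.
have capKI : (lker G :&: limg G = 0)%VS.
  apply/eqP; rewrite -subv0; apply/subvP => y.
  rewrite memv_cap memv_ker => /andP[/eqP Gy /memv_imgP[z _ yE]].
  rewrite memv0; apply: contraT => /(@neq0_dnorm_gt0 _ _ _ ip).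
  by rewrite {1}yE gram_sym Gy linear0r ltxx.
have KI : (lker G + limg G = fullv)%VS.
  apply/eqP; rewrite eqEdim subvf /= dimv_disjoint_sum //.
  by rewrite -(limg_ker_dim G fullv) capfv.
have : x \in (lker G + limg G)%VS by rewrite KI memvf.
move=> /memv_addP[k]; rewrite memv_ker => /eqP Gk [p pI xE].
exists k; first exact: gram_ker.
rewrite xE addrAC subrr add0r; split => //.
have /memv_imgP[z _ ->] := pI.
by rewrite linearDr /= -gram_sym Gk linear0l addr0.
Qed.

Lemma singular_valueP s :
  nonzero_singular_values ip A s <->
  0 < s /\ exists2 v, v != 0 & G v = s ^+ 2 *: v.
Proof.
have eigE v : (v \in lker (G - s ^+ 2 *: \1)%VF) = (G v == s ^+ 2 *: v).
  by rewrite memv_ker add_lfunE opp_lfunE scale_lfunE id_lfunE subr_eq0.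
split=> -[s0 h]; split=> //.
  exists (vpick (lker (G - s ^+ 2 *: \1)%VF)); first by rewrite vpick0.
  by apply/eqP; rewrite -eigE memv_pick.
have [v v0 Gv] := h; apply: contraNneq v0 => K0.
by rewrite -memv0 -K0 eigE Gv.
Qed.

Lemma singular_vector_norm s v : G v = s ^+ 2 *: v ->
  l2norm (A v) ^+ 2 = s ^+ 2 * hnorm ip v ^+ 2.
Proof. by move=> Gv; rewrite -gram_sqr Gv ipZl sqr_hnorm. Qed.

Lemma sigma_min_ge0 : 0 <= sigma_min ip A.
Proof.
rewrite /sigma_min; have [->|S0] := eqVneq (nonzero_singular_values ip A) set0.
  by rewrite inf0.
by apply: lb_le_inf => [|s [/ltW]] //; exact/set0P.
Qed.

Lemma sigma_max_ge0 : 0 <= sigma_max ip A.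
Proof.
rewrite /sigma_max.
have [hs|/sup_out->//] := pselect (has_sup (nonzero_singular_values ip A)).
have [[s Ss] _] := hs; have [s0 _] := Ss.
exact: le_trans (ltW s0) (sup_upper_bound hs Ss).
Qed.

(** [G] maps its image [ker A]^perp into itself, so [rayleigh_min] gives an
    eigenvector of [G] there whose eigenvalue bounds the form of [G] from below.
    This eigenvalue is positive, and every eigenvector of [G] with a nonzero
    eigenvalue lies in the image, so its square root is the infimum defining
    [sigma_min], which is thus positive. If the image is [0], then [sigma_min]
    is [0] but both sides vanish. *)
Lemma sigma_min_bound x : x \in limg G ->
  hnorm ip x <= l2norm (A x) / sigma_min ip A.
Proof.
move=> xG; have [I0|I0] := eqVneq (limg G) 0%VS.
  have -> : x = 0 by move: xG; rewrite I0 memv0 => /eqP.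
  rewrite linear0 (is_norm0 (hnorm_is_norm ip)) (is_norm0 (l2norm_is_norm R m)).
  by rewrite mul0r.
have GG y : y \in limg G -> G y \in limg G by rewrite memv_img ?memvf.
have [v [mu [vG v0 Gv mumin]]] := rayleigh_min gram_sym GG I0.
have vv : 0 < ip v v by exact: neq0_dnorm_gt0.
have mu0 : 0 < mu.
  rewrite -(pmulr_lgt0 _ vv) -ipZl -Gv gram_sqr exprn_even_gt0 //=.
  apply/eqP => /(norm_definite (l2norm_is_norm R m)) Av.
  have : G v = 0 by rewrite comp_lfunE Av linear0.
  have /memv_imgP[z _ vE] := vG.
  by move: vv; rewrite {1}vE gram_sym => /[swap] ->; rewrite linear0r ltxx.
pose s := Num.sqrt mu; have s0 : 0 < s by rewrite sqrtr_gt0.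
have s2 : s ^+ 2 = mu by rewrite sqr_sqrtr // ltW.
have low y : y \in limg G -> s * hnorm ip y <= l2norm (A y).
  move=> yG; rewrite -ler_sqr ?nnegrE ?mulr_ge0 ?hnorm_ge0 ?sqrtr_ge0 //.
  by rewrite exprMn s2 sqr_hnorm -gram_sqr mumin.
have smin : sigma_min ip A = s.
  have sS : nonzero_singular_values ip A s.
    by apply/singular_valueP; split => //; exists v; rewrite ?s2.
  have slb : lbound (nonzero_singular_values ip A) s.
    move=> t /singular_valueP[t0 [w w0 Gw]].
    have wG : w \in limg G.
      have -> : w = G ((t ^+ 2)^-1 *: w).
        by rewrite linearZ /= Gw scalerA mulVf ?scale1r ?expf_neq0 ?gt_eqF.
      by rewrite memv_img ?memvf.
    have ww : 0 < hnorm ip w by rewrite (is_norm_gt0 (hnorm_is_norm ip)).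
    rewrite -(ler_pM2r ww); apply: le_trans (low _ wG) _.
    rewrite -ler_sqr ?nnegrE ?mulr_ge0 ?sqrtr_ge0 ?(ltW t0) //.
    by rewrite (singular_vector_norm Gw) exprMn.
  apply/eqP; rewrite eq_le; apply/andP; split; first by apply: ge_inf => //; exists s.
  by apply: lb_le_inf => //; exists s.
by rewrite smin ler_pdivlMr // mulrC low.
Qed.

(** The largest eigenvalue of [G] is minus the smallest one of [- G]. *)
Lemma sigma_max_bound x : l2norm (A x) <= sigma_max ip A * hnorm ip x.
Proof.
have [V0|V0] := eqVneq (fullv : {vspace V}) 0%VS.
  have -> : x = 0 by have := memvf x; rewrite V0 memv0 => /eqP.
  rewrite linear0 (is_norm0 (hnorm_is_norm ip)) (is_norm0 (l2norm_is_norm R m)).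
  by rewrite mulr0.
have NGE y : (- G)%VF y = - G y by rewrite opp_lfunE.
have [||v [mu [_ v0 Gv mumax]]] := @rayleigh_min _ _ ip fullv (- G)%VF _ _ V0.
- by move=> y z; rewrite !NGE linearNl linearNr /= gram_sym.
- by move=> y _; rewrite memvf.
have {}mumax y : l2norm (A y) ^+ 2 <= - mu * hnorm ip y ^+ 2.
  rewrite -gram_sqr sqr_hnorm mulNr lerNr.
  by have := mumax y (memvf y); rewrite NGE linearNl.
have vv : 0 < hnorm ip v by rewrite (is_norm_gt0 (hnorm_is_norm ip)).
have mu0 : 0 <= - mu.
  by rewrite -(pmulr_lge0 _ (exprn_gt0 2 vv)); apply: le_trans (mumax v); rewrite sqr_ge0.
pose s := Num.sqrt (- mu); have s2 : s ^+ 2 = - mu by rewrite sqr_sqrtr.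
have up y : l2norm (A y) <= s * hnorm ip y.
  rewrite -ler_sqr ?nnegrE ?mulr_ge0 ?hnorm_ge0 ?sqrtr_ge0 //.
  by rewrite exprMn s2.
apply: le_trans (up x) _; rewrite ler_wpM2r ?hnorm_ge0 //.
have sub : ubound (nonzero_singular_values ip A) s.
  move=> t /singular_valueP[t0 [w w0 Gw]].
  have ww : 0 < hnorm ip w by rewrite (is_norm_gt0 (hnorm_is_norm ip)).
  rewrite -(ler_pM2r ww); apply: le_trans (up w).
  rewrite -ler_sqr ?nnegrE ?mulr_ge0 ?sqrtr_ge0 ?(ltW t0) //.
  by rewrite (singular_vector_norm Gw) exprMn.
have [s0|s0] := eqVneq s 0; last first.
  apply: ub_le_sup; first by exists s.
  apply/singular_valueP; split; first by rewrite lt_def s0 sqrtr_ge0.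
  exists v => //; rewrite s2 scaleNr -Gv NGE opprK //.
by rewrite s0 sigma_max_ge0.
Qed.

End SingularValues.

(** * Stable recovery *)

Section Recovery.
Variables (R : realType) (V : vectType R) (ip : {dot V for idfun}).
Variables (N : V -> R) (hN : is_norm N).
Variables (m : nat) (A : 'Hom(V, 'cV[R]_m)).

(** The sine of [Num.min theta (pi / 2)]: once [theta] is at least a right angle,
    the expansion around a vector contains [k] or [- k] for every [k], so that
    larger angles exclude nothing more. *)
Definition sin_acute (theta : R) : R := Num.sqrt (1 - Num.max 0 (cos theta) ^+ 2).

Lemma sin_acute_gt0 theta : 0 < theta <= pi -> 0 < sin_acute theta.
Proof.
move=> /andP[t0 tpi]; rewrite sqrtr_gt0 subr_gt0 -(expr1n _ 2).
rewrite ltr_sqr ?nnegrE ?le_max ?lexx // gt_max ltr01 /=.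
by rewrite -cos0 ltr_cos ?in_itv /= ?lexx ?pi_ge0 ?(ltW t0).
Qed.

Lemma descent_coneZ (l : R) x0 : 0 < l ->
  descent_cone N (l *: x0) `<=` descent_cone N x0.
Proof.
move=> l0 y [tau tau0 h]; exists (tau / l); first by rewrite divr_gt0.
rewrite -(ler_pM2l l0) -{1 3}(gtr0_norm l0) -!(norm_homogeneous hN).
by rewrite scalerDr scalerA mulrCA divff ?gt_eqF // mulr1.
Qed.

(** Were the projection [k] of [y] on [ker A] longer than [cos theta] times [y],
    it would lie in the expansion of [D], since [ip k y] is the square of the
    norm of [k]. So it is shorter, and Pythagoras bounds [y - k] from below. *)
Lemma descent_cone_transverse (theta : R) (D : set V) y :
  expansion ip theta D `&` [set x | x \in lker A] = [set 0] ->
  D y -> sin_acute theta * hnorm ip y <= l2norm (A y) / sigma_min ip A.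
Proof.
move=> expA Dy; have [k Ak [pG ky]] := ker_split ip A y.
have Ap : A (y - k) = A y by rewrite linearB /= Ak subr0.
rewrite -Ap; apply: le_trans (sigma_min_bound pG).
rewrite -ler_sqr ?nnegrE ?mulr_ge0 ?hnorm_ge0 ?sqrtr_ge0 //.
set c := Num.max 0 (cos theta); have c0 : 0 <= c by rewrite le_max lexx.
have kc : hnorm ip k <= c * hnorm ip y.
  rewrite leNgt; apply/negP => ck.
  have k0 : k = 0.
    have : (expansion ip theta D `&` [set x | x \in lker A]) k.
      split; last by rewrite /= memv_ker Ak.
      right; exists y; split => //.
        apply: contraTneq ck => y0; move: ky; rewrite y0 linear0r => /esym kk.
        by rewrite -leNgt /hnorm kk sqrtr0 mulr_ge0 ?sqrtr_ge0.
      rewrite ky -sqr_hnorm expr2 mulrAC ler_wpM2r ?hnorm_ge0 //.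
      apply: le_trans (ltW ck); rewrite ler_wpM2r ?hnorm_ge0 //.
      by rewrite /c le_max lexx orbT.
    by rewrite expA.
  move: ck; rewrite k0 (is_norm0 (hnorm_is_norm ip)) ltNge.
  by rewrite mulr_ge0 ?hnorm_ge0.
have c1 : c ^+ 2 <= 1.
  by rewrite expr_le1 // /c ge_max ler01 cos_le1.
rewrite exprMn sqr_sqrtr ?subr_ge0 // !sqr_hnorm.
have -> : ip (y - k) (y - k) = ip y y - ip k k.
  rewrite linearBl /= !linearBr /= (ipC ip y k) ky; ring.
rewrite mulrBl mul1r lerD2l lerN2 -!sqr_hnorm -exprMn.
by rewrite ler_sqr ?nnegrE ?mulr_ge0 ?hnorm_ge0.
Qed.

(** If [N xs > N x0], take [t = N x0 / N xs]: the loss [(1 - t) * N xs] is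
    [N xs - N x0 <= N xc - N x0]. *)
Lemma shrink_to_sublevel x0 xc xs : N xs <= N xc ->
  exists2 t, 0 <= 1 - t & N (t *: xs) <= N x0 /\ (1 - t) * N xs <= N (xc - x0).
Proof.
move=> sc; have [le|lt] := leP (N xs) (N x0).
  exists 1; first by rewrite subrr.
  by rewrite scale1r subrr mul0r is_norm_ge0.
have s0 : 0 < N xs by apply: le_lt_trans lt; exact: is_norm_ge0.
have t0 : 0 <= N x0 / N xs by rewrite divr_ge0 ?is_norm_ge0.
exists (N x0 / N xs); first by rewrite subr_ge0 ler_pdivrMr // mul1r ltW.
rewrite (norm_homogeneous hN) ger0_norm // mulrBl mul1r divfK ?gt_eqF //.
split => //; apply: le_trans (is_norm_dist hN _ _).
by apply: le_trans (ler_norm _); rewrite lerD2r.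
Qed.

Lemma recovery_bound (c s eps : R) x0 xc xs :
  0 <= c -> (forall x, hnorm ip x <= c * N x) -> 0 < s ->
  (forall y, descent_cone N x0 y ->
     s * hnorm ip y <= l2norm (A y) / sigma_min ip A) ->
  N xs <= N xc -> l2norm (A (xs - xc)) <= 2 * eps ->
  hnorm ip (xs - xc) <= 2 / (sigma_min ip A * s) * eps +
    2 * c * (1 + sigma_max ip A / sigma_min ip A / s) * N (xc - x0).
Proof.
move=> c0 ipN s0 gap sc Ah.
(* y is the descent direction, h the error to bound, and e their difference. *)
have [t t1 [tx0 txs]] := shrink_to_sublevel x0 sc.
set h := xs - xc; set d := N (xc - x0); pose y := t *: xs - x0.
pose e := y - h.
have eE : e = - ((1 - t) *: xs) + (xc - x0).
  rewrite /e /y /h scalerBl scale1r !opprB addrACA [RHS]addrAC.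
  by rewrite -!addrA [- x0 + _]addrC !addrA.
have e_le : hnorm ip e <= 2 * c * d.
  apply: le_trans (ipN e) _; rewrite -mulrA mulrCA ler_wpM2l // eE.
  apply: le_trans (norm_triangle hN _ _) _.
  rewrite is_normN // (norm_homogeneous hN) ger0_norm // -/d.
  by move: txs; rewrite -/d; lra.
have Dy : descent_cone N x0 y.
  by exists 1 => //; rewrite scale1r /y addrC subrK.
have hE : h = y - e by rewrite /e opprB addrC subrK.
have sg : 0 <= (sigma_min ip A)^-1 by rewrite invr_ge0 sigma_min_ge0.
have Ay : l2norm (A y) <= 2 * eps + sigma_max ip A * (2 * c * d).
  have -> : y = h + e by rewrite /e addrC subrK.
  rewrite linearD; apply: le_trans (norm_triangle (l2norm_is_norm R m) _ _) _.
  apply: lerD => //; apply: le_trans (sigma_max_bound _ _ _) _.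
  apply: ler_wpM2l e_le; exact: sigma_max_ge0.
have y_le : hnorm ip y <=
    (2 * eps + sigma_max ip A * (2 * c * d)) / sigma_min ip A / s.
  rewrite ler_pdivlMr // mulrC; apply: le_trans (gap y Dy) _.
  by rewrite ler_wpM2r.
rewrite hE; apply: le_trans (is_norm_sub (hnorm_is_norm ip) _ _) _.
apply: le_trans (lerD y_le e_le) _.
rewrite le_eqVlt; apply/orP; left; apply/eqP.
by rewrite invfM; ring.
Qed.

End Recovery.

(* kappa1 and kappa2 are functions of (sigma_min, theta) and (theta, condition
   number), chosen before m, A, C, theta, eps and the data: this is the claimed
   dependence of the constants, for a fixed space H and norm N. *)
Theorem theorem12 (R : realType) (H : vectType R) (ip : {dot H for idfun})
    (N : H -> R) (hN : is_norm N) :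
  exists kappa1 kappa2 : R -> R -> R,
  forall (m : nat) (A : 'Hom(H, 'cV[R]_m)) (C : set H) (theta : R),
    0 < theta <= pi ->
    (forall x0 : H, C x0 ->
       expansion ip theta (descent_cone N x0) `&` [set x | x \in lker A]
       = [set 0]) ->
  forall (eps : R) (xc : H) (n : 'cV[R]_m),
    0 <= eps -> l2norm n <= eps ->
  forall xs : H, is_solution N A (A xc + n) eps xs ->
    ((hnorm ip (xs - xc))%:E <=
     (kappa1 (sigma_min ip A) theta * eps)%:E +
     (kappa2 theta (sigma_max ip A / sigma_min ip A))%:E
       * edist N xc (cone C))%E.
Proof.
have [c c0 ipN] := norms_equivalent (hnorm_is_norm ip) hN.
exists (fun sigma theta => 2 / (sigma * sin_acute theta)).
exists (fun theta kappa => 2 * c * (1 + kappa / sin_acute theta)).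
move=> m A C theta theta_pi capC eps xc n eps0 n_eps xs [xs_feas xs_min].
have gap0 := sin_acute_gt0 theta_pi.
have hl2 := l2norm_is_norm R m.
have xs_xc : N xs <= N xc.
  by apply: xs_min; rewrite opprD addrA subrr add0r (is_normN hl2).
have Ah : l2norm (A (xs - xc)) <= 2 * eps.
  have -> : A (xs - xc) = A xs - (A xc + n) + n.
    by rewrite linearB /= opprD addrA subrK.
  apply: le_trans (norm_triangle hl2 _ _) _.
  by rewrite mulr_natl mulr2n lerD.
set k2 := 2 * c * _; have k2_gt0 : 0 < k2.
  rewrite mulr_gt0 ?mulr_gt0 // ltr_pwDl // divr_ge0 ?(ltW gap0) //.
  by rewrite divr_ge0 ?sigma_min_ge0 ?sigma_max_ge0.
(* As k2 > 0, it suffices to bound every N (xc - x0) from below; this form also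
   covers an empty C, where the infimum is +oo. *)
rewrite -leeBlDl // -EFinB muleC -lee_pdivrMr //.
apply: le_ereal_inf_tmp => _ [_ [l [x0 [l0 Cx0 ->]]] <-].
rewrite -EFinM lee_fin ler_pdivrMr // lerBlDl [N _ * _]mulrC.
apply: recovery_bound (ltW c0) ipN gap0 _ xs_xc Ah => // y Dy.
apply: descent_cone_transverse (capC _ Cx0) _; exact: descent_coneZ Dy.
Qed.
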